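(* Suppose $\mathsf{p}\in\mathbb{R}[\mathcal{V}_n]$ is $\mathfrak{S}_n$-invariant and $d$-sos. For each partition $\bm{\lambda}\vdash n$, fix a tableau $\tau_{\bm{\lambda}}$ of shape $\bm{\lambda}$ and let $\{\mathsf{p}^{\tau_{\bm{\lambda}}}_1,\dots,\mathsf{p}^{\tau_{\bm{\lambda}}}_{l_{\tau_{\bm{\lambda}}}}\}$ be a set of polynomials whose span contains $W_{\tau_{\bm{\lambda}}}$. Then for each $\bm{\lambda}\in\Lambda$ there exists an $l_{\tau_{\bm{\lambda}}}\times l_{\tau_{\bm{\lambda}}}$ positive semidefinite matrix $R_{\bm{\lambda}}$ such that \[\mathsf{p}=\sum_{\bm{\lambda}\in\Lambda}\textup{tr}(R_{\bm{\lambda}}Z^{\tau_{\bm{\lambda}}}),\] where $Z^{\tau_{\bm{\lambda}}}_{ij}:=\textup{sym}(\mathsf{p}^{\tau_{\bm{\lambda}}}_i\mathsf{p}^{\tau_{\bm{\lambda}}}_j)$.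
   Context: Fix positive integers $n,d$. $\mathbb{R}[\mathsf{x}]$ is the polynomial ring in variables $\mathsf{x}_{ij}$, $1\le i<j\le n$ ($\mathsf{x}_{ji}:=\mathsf{x}_{ij}$); $\mathcal{V}_n=\{0,1\}^{\binom n2}$; $\mathcal{I}_n$ is the ideal generated by all $\mathsf{x}_{ij}^2-\mathsf{x}_{ij}$; $\mathbb{R}[\mathcal{V}_n]=\mathbb{R}[\mathsf{x}]/\mathcal{I}_n$ (functions on $\mathcal{V}_n$, identified with square-free polynomials), and $\mathbb{R}[\mathcal{V}_n]_{\le d}$ consists of those represented by polynomials of degree at most $d$. $\mathfrak{S}_n$ acts by ring automorphisms with $\mathfrak{s}\cdot\mathsf{x}_{ij}=\mathsf{x}_{\mathfrak{s}(i)\mathfrak{s}(j)}$; $\mathsf{p}$ is $\mathfrak{S}_n$-invariant if fixed by it. $\mathsf{p}$ is $d$-sos if $\mathsf{p}=\sum_k\mathsf{f}_k^2$ in $\mathbb{R}[\mathcal{V}_n]$ with $\mathsf{f}_k\in\mathbb{R}[\mathcal{V}_n]_{\le d}$. $\textup{sym}(\mathsf{f}):=\frac1{n!}\sum_{\mathfrak{s}\in\mathfrak{S}_n}\mathfrak{s}\cdot\mathsf{f}$. Let $V=\mathbb{R}[\mathcal{V}_n]_{\le d}$ with isotypic decomposition $V=\bigoplus_{\bm{\lambda}\vdash n}V_{\bm{\lambda}}$, where $V_{\bm{\lambda}}$ is the span of all submodules isomorphic to the irreducible module $S_{\bm{\lambda}}$. For a tableau $\tau_{\bm{\lambda}}$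 of shape $\bm{\lambda}$ (bijective filling of the Young diagram with $1,\dots,n$), its row group $\mathfrak{R}_{\tau_{\bm{\lambda}}}$ is the subgroup of $\mathfrak{S}_n$ preserving each row's set of labels, and $W_{\tau_{\bm{\lambda}}}:=V_{\bm{\lambda}}^{\mathfrak{R}_{\tau_{\bm{\lambda}}}}$ is the set of elements of $V_{\bm{\lambda}}$ fixed by the row group. $\Lambda:=\{\bm{\lambda}\vdash n:\bm{\lambda}\geq_{\textup{lex}}(n-2d,1^{2d})\}$ with $\geq_{\textup{lex}}$ the lexicographic order and $(n-2d,1^{2d})$ the hook partition with first part $n-2d$ and $2d$ parts equal to $1$. *)

(* Defs.v *)
From HB Require Import structures.
From mathcomp Require Import all_boot all_order all_fingroup all_algebra.
From mathcomp Require Import reals.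
Set Implicit Arguments. Unset Strict Implicit. Unset Printing Implicit Defensive.
Import Order.TTheory GRing.Theory Num.Theory.
Local Open Scope ring_scope.

Section Defs.
Variable R : realType.
Variable n : nat.

(* Edges {i,j}, i <> j, of K_n: the index set of the variables x_ij. *)
Definition edge := {A : {set 'I_n} | #|A| == 2}.
(* A point of V_n = {0,1}^(n choose 2) is the set of edges where x_e = 1. *)
Definition point := {set edge}.
(* R[V_n] : real-valued functions on V_n (= square-free polynomials). *)
Definition fn := {ffun point -> R^o}.

Definition fmul (f g : fn) : fn := [ffun x => f x * g x].

(* the square-free monomial prod_{e in S} x_e, as a function on V_n *)
Definition mono (S : {set edge}) : fn := [ffun g : point => ((S \subset g) : nat)%:R].

Definition deg_le (d : nat) (f : fn) : Prop :=
  exists c : {set edge} -> R, f = \sum_(S : {set edge} | (#|S| <= d)%N) c S *: mono S.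

(* action of S_n: (s . f)(g) = f(s^{-1} g), so that s . x_ij = x_{s(i) s(j)};
   this is a left action for the composition of permutations as functions. *)
Definition pact (s : {perm 'I_n}) (f : fn) : fn :=
  [ffun g : point => f [set e : edge | [exists e' in g, val e' == s @: val e]]].

Definition Sn_invariant (f : fn) : Prop := forall s, pact s f = f.

Definition sym (f : fn) : fn := (n`!%:R)^-1 *: \sum_(s : {perm 'I_n}) pact s f.

Definition is_dsos (d : nat) (p : fn) : Prop :=
  exists m (fs : 'I_m -> fn), (forall k, deg_le d (fs k)) /\
    p = \sum_(k < m) fmul (fs k) (fs k).

(* Partitions of n, padded with zeros to length n. *)
Definition npartition := {t : n.-tuple 'I_n.+1 |
  sorted geq [seq val x | x <- t] && (\sum_(x <- t) val x == n)%N}.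
Definition parts (la : npartition) : seq nat := [seq x <- [seq val x | x <- val la] | 0 < x]%N.

Fixpoint lex_le (a b : seq nat) : bool :=
  match a, b with
  | [::], _ => true
  | _ :: _, [::] => false
  | x :: a', y :: b' => (x < y)%N || ((x == y) && lex_le a' b')
  end.

Definition inLambda (d : nat) (la : npartition) : bool :=
  lex_le ((n - 2 * d)%N :: nseq (2 * d) 1%N) (parts la).

(* A tableau of shape la: label i sits in cell t i = (row, column) (0-based);
   t is a bijection from labels onto the Young diagram of la. *)
Definition is_tableau (la : npartition) (t : 'I_n -> nat * nat) : Prop :=
  injective t /\ (forall i, ((t i).2 < nth 0 (parts la) (t i).1)%N) /\
  (forall r c, (c < nth 0 (parts la) r)%N -> exists i, t i = (r, c)).

Definition rowgroup (t : 'I_n -> nat * nat) : {set {perm 'I_n}} :=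
  [set s : {perm 'I_n} | [forall i, (t (s i)).1 == (t i).1]].
Definition colgroup (t : 'I_n -> nat * nat) : {set {perm 'I_n}} :=
  [set s : {perm 'I_n} | [forall i, (t (s i)).2 == (t i).2]].

(* Group algebra R[S_n], F <-> sum_g F g g, product = composition of functions;
   note mathcomp's (u * s) is "first u then s", i.e. s o u. *)
Definition ga := {ffun {perm 'I_n} -> R^o}.
(* left multiplication by s: (s . F)(h) = F(s^{-1} o h) *)
Definition gact (s : {perm 'I_n}) (F : ga) : ga := [ffun h => F (h * s^-1)%g].

(* Young symmetrizer c_t = (sum_{r in R_t} r) o (sum_{c in C_t} sgn(c) c) *)
Definition young_sym (t : 'I_n -> nat * nat) : ga :=
  [ffun g => \sum_(r in rowgroup t) \sum_(c in colgroup t)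
              ((g == (c * r)%g) : nat)%:R * (-1) ^+ odd_perm c].

Definition specht (t : 'I_n -> nat * nat) : {vspace ga} :=
  <<[seq gact s (young_sym t) | s <- enum {perm 'I_n}]>>%VS.

Definition iso_submod (d : nat) (t : 'I_n -> nat * nat) (U : {vspace fn}) : Prop :=
  (forall u, u \in U -> deg_le d u) /\
  (forall s u, u \in U -> pact s u \in U) /\
  exists phi : 'Hom(ga, fn),
    (phi @: specht t)%VS = U /\ (lker phi :&: specht t = 0)%VS /\
    (forall s x, x \in specht t -> phi (gact s x) = pact s (phi x)).

Definition isotypic (d : nat) (t : 'I_n -> nat * nat) (v : fn) : Prop :=
  exists m (us : 'I_m -> fn), v = \sum_(k < m) us k /\
    forall k, exists U, iso_submod d t U /\ us k \in U.

Definition in_W (d : nat) (t : 'I_n -> nat * nat) (v : fn) : Prop :=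
  isotypic d t v /\ forall s, s \in rowgroup t -> pact s v = v.

Definition in_span (l : nat) (ps : 'I_l -> fn) (v : fn) : Prop :=
  exists c : 'I_l -> R, v = \sum_(i < l) c i *: ps i.

Definition psd (l : nat) (M : 'M[R]_l) : Prop :=
  M^T = M /\ forall x : 'cV[R]_l, 0 <= (x^T *m M *m x) 0 0.

Definition Zmat (l : nat) (ps : 'I_l -> fn) (i j : 'I_l) : fn :=
  sym (fmul (ps i) (ps j)).

End Defs.

(* Main.v *)
Require Import Defs.
From HB Require Import structures.
From mathcomp Require Import all_boot all_order all_fingroup all_algebra.
From mathcomp Require Import boolp reals zify.
Import Order.TTheory GRing.Theory Num.Theory.
Local Open Scope ring_scope.

(* Work in the real group algebra A of S_n. The sums z_la of the conjugates of
   the Young symmetrizers are central, mutually orthogonal and nonzero, and there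
   are at least as many partitions as conjugacy classes, so they form a basis of
   the center and 1 is the sum of orthogonal idempotents e_la proportional to
   the z_la. With r the row sum of tau_la, the sum of the conjugates of r e_la
   is central, hence a multiple a e_la, and a > 0 by positivity of the trace
   F |-> (F^* F)(1). As r is proportional to r^* r, this writes 1 as a
   nonnegative combination of the x^* x with x = r g e_la. Finally
   sym ((x^* x f) f) = sym ((x f)^2), where x f is in W, and x f vanishes for f
   of degree at most d unless la is in Lambda. *)

Set Implicit Arguments. Unset Strict Implicit. Unset Printing Implicit Defensive.

(** * The group algebra *)

(* An alias is needed: {ffun gT -> R^o} already carries the pointwise product. *)
Definition galg (R : comNzRingType) (gT : finGroupType) := {ffun gT -> R^o}.

Section GroupAlgebra.
Variables (R : comNzRingType) (gT : finGroupType).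
Implicit Types (F G H : galg R gT) (s t : gT).

HB.instance Definition _ := GRing.Lmodule.on (galg R gT).

Definition delta s : galg R gT := [ffun g => (g == s)%:R].
(* The convolution for which delta s * delta t = delta (t * s): in {perm T} the
   product t * s is the composite of t followed by s. *)
Definition galg_mul F G : galg R gT := [ffun h => \sum_g F g * G (h * g^-1)%g].
(** The adjoint: [(star F * G) 1] is the standard inner product of [F] and [G]. *)
Definition star F : galg R gT := [ffun g => F g^-1%g].

Fact galg_mulA : associative galg_mul.
Proof.
move=> F G H; apply/ffunP => h; rewrite !ffunE.
under eq_bigr => g _ do rewrite ffunE mulr_sumr.
under [RHS]eq_bigr => k _ do rewrite ffunE mulr_suml.
rewrite [RHS]exchange_big; apply: eq_bigr => g _ /=.
rewrite [RHS](reindex_inj (mulIg g)); apply: eq_bigr => k _ /=.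
by rewrite mulrA mulgK invMg mulgA.
Qed.

Fact galg_mul1 : left_id (delta 1) galg_mul.
Proof.
move=> F; apply/ffunP => h; rewrite ffunE (bigD1 1%g) //= big1 => [|g /negPf ne].
  by rewrite ffunE eqxx mul1r invg1 mulg1 addr0.
by rewrite ffunE ne mul0r.
Qed.

Fact galg_1mul : right_id (delta 1) galg_mul.
Proof.
move=> F; apply/ffunP => h; rewrite ffunE (bigD1 h) //= big1 => [|g ne].
  by rewrite ffunE mulgV eqxx mulr1 addr0.
by rewrite ffunE -eq_mulgV1 eq_sym (negPf ne) mulr0.
Qed.

Fact galg_mulDl : left_distributive galg_mul +%R.
Proof.
move=> F G H; apply/ffunP => h; rewrite !ffunE -big_split.
by apply: eq_bigr => g _; rewrite ffunE mulrDl.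
Qed.

Fact galg_mulDr : right_distributive galg_mul +%R.
Proof.
move=> F G H; apply/ffunP => h; rewrite !ffunE -big_split.
by apply: eq_bigr => g _; rewrite ffunE mulrDr.
Qed.

Fact galg_1neq0 : delta 1 != 0.
Proof. by apply/eqP => /ffunP/(_ 1%g)/eqP; rewrite !ffunE eqxx oner_eq0. Qed.

HB.instance Definition _ := GRing.Zmodule_isNzRing.Build (galg R gT)
  galg_mulA galg_mul1 galg_1mul galg_mulDl galg_mulDr galg_1neq0.

Fact galg_scaleAl (a : R) F G : a *: (F * G) = (a *: F) * G.
Proof.
apply/ffunP => h; rewrite !ffunE scaler_sumr.
by apply: eq_bigr => g _; rewrite ffunE scalerAl.
Qed.

HB.instance Definition _ := GRing.Lmodule_isLalgebra.Build R (galg R gT)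
  galg_scaleAl.

Fact galg_scaleAr (a : R) F G : a *: (F * G) = F * (a *: G).
Proof.
apply/ffunP => h; rewrite !ffunE scaler_sumr.
by apply: eq_bigr => g _; rewrite ffunE scalerAr.
Qed.

HB.instance Definition _ := GRing.Lalgebra_isAlgebra.Build R (galg R gT)
  galg_scaleAr.

Lemma galgE F G h : (F * G) h = \sum_g F g * G (h * g^-1)%g.
Proof. by rewrite ffunE. Qed.

Lemma delta1 : delta 1 = 1. Proof. by []. Qed.

Lemma delta_mulE s F h : (delta s * F) h = F (h * s^-1)%g.
Proof.
rewrite galgE (bigD1 s) //= big1 => [|g /negPf ne].
  by rewrite ffunE eqxx mul1r addr0.
by rewrite ffunE ne mul0r.
Qed.

Lemma mul_deltaE s F h : (F * delta s) h = F (s^-1 * h)%g.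
Proof.
rewrite galgE (bigD1 (s^-1 * h)%g) //= big1 => [|g ne].
  by rewrite ffunE invMg invgK mulKVg eqxx mulr1 addr0.
rewrite ffunE; case: eqP => [e|]; last by rewrite mulr0.
by case/eqP: ne; rewrite -e invMg invgK mulgKV.
Qed.

Lemma deltaM s t : delta s * delta t = delta (t * s)%g.
Proof. by apply/ffunP => h; rewrite delta_mulE !ffunE (canF_eq (mulgKV s)). Qed.

Lemma delta_sum F : F = \sum_g F g *: delta g.
Proof.
apply/ffunP => h; rewrite sum_ffunE (bigD1 h) //= big1 => [|g ne].
  by rewrite !ffunE eqxx addr0; apply/esym/mulr1.
by rewrite !ffunE eq_sym (negPf ne); apply: mulr0.
Qed.

Lemma galg_act F G : F * G = \sum_g F g *: (delta g * G).
Proof.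
by rewrite {1}(delta_sum F) mulr_suml; apply: eq_bigr => g _; rewrite scalerAl.
Qed.

Lemma starK : involutive star.
Proof. by move=> F; apply/ffunP => g; rewrite !ffunE invgK. Qed.

Lemma starM F G : star (F * G) = star G * star F.
Proof.
apply/ffunP => h; rewrite ffunE !galgE (reindex_inj (mulIg h^-1%g)).
by apply: eq_bigr => g _ /=; rewrite !ffunE !invMg !invgK mulrC mulKg.
Qed.

Lemma star_delta s : star (delta s) = delta s^-1%g.
Proof. by apply/ffunP => h; rewrite !ffunE eq_invg_sym. Qed.

Lemma star_is_linear : linear star.
Proof. by move=> a F G; apply/ffunP => h; rewrite !ffunE. Qed.

HB.instance Definition _ :=
  GRing.isLinear.Build R (galg R gT) (galg R gT) _ star star_is_linear.

Lemma star_mul1 F : (star F * F) 1%g = \sum_g F g ^+ 2.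
Proof.
rewrite galgE (reindex_inj invg_inj); apply: eq_bigr => g _.
by rewrite ffunE invgK mul1g.
Qed.

Lemma galg_central F :
  (forall s, delta s * F = F * delta s) -> forall G, G * F = F * G.
Proof.
move=> FC G; rewrite (delta_sum G) mulr_suml mulr_sumr; apply: eq_bigr => g _.
by rewrite -scalerAl FC scalerAr.
Qed.

Lemma galg_central_class F s t :
  (forall s, delta s * F = F * delta s) -> F (s ^ t)%g = F s.
Proof.
move=> FC; have := congr1 (fun X : galg R gT => X (s * t)%g) (FC t).
by rewrite mul_deltaE delta_mulE mulgK.
Qed.

(** The projection onto the center up to the factor [#|gT|], left undivided so that it makes sense
    over any commutative ring. *)
Definition conj_sum F : galg R gT := \sum_g delta g^-1%g * F * delta g.

Lemma conj_sum_central F s : delta s * conj_sum F = conj_sum F * delta s.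
Proof.
rewrite mulr_sumr mulr_suml (reindex_inj (mulgI s)); apply: eq_bigr => g _ /=.
by rewrite -deltaM !mulrA deltaM invMg mulgKV.
Qed.

Lemma conj_sum1 F : conj_sum F 1%g = #|gT|%:R * F 1%g.
Proof.
rewrite sum_ffunE (eq_bigr (fun=> F 1%g)) => [|g _]; last first.
  by rewrite mul_deltaE delta_mulE invgK mulg1 mulVg.
by rewrite sumr_const mulr_natl.
Qed.

Lemma conj_sumMr F G :
  (forall H, H * G = G * H) -> conj_sum (F * G) = conj_sum F * G.
Proof.
move=> GC; rewrite mulr_suml; apply: eq_bigr => g _.
by rewrite -!mulrA GC !mulrA.
Qed.

Lemma conj_sum_eq0l F G : (forall g, F * delta g * G = 0) -> F * conj_sum G = 0.
Proof.
move=> FG0; rewrite mulr_sumr big1 // => g _.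
by rewrite !mulrA FG0 mul0r.
Qed.

Lemma conj_sum_eq0r F G : (forall g, F * delta g * G = 0) -> conj_sum F * G = 0.
Proof.
move=> FG0; rewrite mulr_suml big1 // => g _.
by rewrite -!mulrA (mulrA F) FG0 mulr0.
Qed.

End GroupAlgebra.

(** * Positivity of the trace *)

Section GroupAlgebraReal.
Variables (R : realDomainType) (gT : finGroupType).
Implicit Types F G : galg R gT.

Lemma star_mul1_ge0 F : 0 <= (star F * F) 1%g.
Proof. by rewrite star_mul1 sumr_ge0 // => g _; rewrite sqr_ge0. Qed.

Lemma star_mul1_eq0 F : (star F * F) 1%g = 0 -> F = 0.
Proof.
rewrite star_mul1 => /eqP; rewrite psumr_eq0 => [/allP F0|g _]; last exact: sqr_ge0.
apply/ffunP => g; rewrite ffunE; apply/eqP; rewrite -sqrf_eq0.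
exact: implyP (F0 g (mem_index_enum g)) isT.
Qed.

Lemma star_mul_eq0 F : star F * F = 0 -> F = 0.
Proof. by move=> F0; apply: star_mul1_eq0; rewrite F0 ffunE. Qed.

Lemma star_mul1_gt0 F : F != 0 -> 0 < (star F * F) 1%g.
Proof.
move=> F0; rewrite lt_def star_mul1_ge0 andbT.
by apply: contra_neq F0 => /star_mul1_eq0.
Qed.

(* The real group algebra has no nonzero nilpotent left ideal: y := x* x is
   self-adjoint and y y = 0. *)
Lemma galg_semiprime F : (forall G, F * G * F = 0) -> F = 0.
Proof.
move=> F0; apply/star_mul_eq0/star_mul_eq0.
by rewrite starM starK -!mulrA (mulrA F) F0 mulr0.
Qed.

End GroupAlgebraReal.

(** * Cycle types *)

(** Serves to pair the cycles of two permutations by length; [y0] is only a default for [nth]. *)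
Lemma perm_eq_map_transport (S T : eqType) (C : eqType) (f : S -> C) (g : T -> C)
    (s : seq S) (t : seq T) (y0 : T) :
  perm_eq (map f s) (map g t) ->
  exists2 t', perm_eq t' t & map f s = map g t'.
Proof.
move=> /(perm_iotaP (g y0))[I pI eI]; rewrite size_map in pI.
exists [seq nth y0 t i | i <- I].
  by rewrite -[X in perm_eq _ X](mkseq_nth y0) perm_map.
rewrite eI -map_comp; apply/eq_in_map => i.
by rewrite (perm_mem pI) mem_iota /= add0n => lti; rewrite (nth_map y0).
Qed.

Section SymmetricGroupConjugacy.
Variable T : finType.
Implicit Types (s : {perm T}) (x y : T).

Definition cycle_sizes s : seq nat := [seq #|pred_of_set X| | X <- enum (porbits s)].

Lemma permX_eq_mod s x i j :
  ((s ^+ i)%g x == (s ^+ j)%g x) = (i == j %[mod #|porbit s x|]).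
Proof.
set m := #|porbit s x|; have m0 : (0 < m)%N by rewrite lt0n card_porbit_neq0.
have red k : (s ^+ k)%g x = nth x (traject s x m) (k %% m).
  rewrite nth_traject ?ltn_mod // -permX {1}(divn_eq k m) addnC expgD permM.
  set y := (s ^+ (k %% m))%g x.
  have -> : m = #|porbit s y| by rewrite /y porbit_perm.
  by rewrite mulnC expgM permX; elim: (_ %/ _)%N => //= q ->;
     rewrite permX iter_porbit.
rewrite !red nth_uniq ?size_traject ?ltn_mod //.
exact: uniq_traject_porbit.
Qed.

(** Cycles are paired by length through [phi] and a base point is chosen in each; the conjugator
    sends [s ^+ i] of a base point to [t ^+ i] of the base point of the paired cycle. *)
Lemma cycle_sizes_conj s t :
  perm_eq (cycle_sizes s) (cycle_sizes t) -> exists h, (s ^ h)%g = t.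
Proof.
move=> /(perm_eq_map_transport set0)[l' pl' el'].
set l := enum (porbits s) in el'.
have szl : size l = size l' by have := congr1 size el'; rewrite !size_map.
pose phi X := nth set0 l' (index X l).
have lP X : (X \in l) = (X \in porbits s) by rewrite mem_enum.
have l'P X : (X \in l') = (X \in porbits t) by rewrite (perm_mem pl') mem_enum.
have phi_in X : X \in porbits s -> phi X \in porbits t.
  by rewrite -lP -l'P -index_mem => i; rewrite mem_nth // -szl.
have phi_card X : X \in porbits s -> #|phi X| = #|X|.
  rewrite -lP => Ol; have i : (index X l < size l)%N by rewrite index_mem.
  have := congr1 (fun u => nth 0%N u (index X l)) el'.
  by rewrite (nth_map set0) // nth_index // (nth_map set0) -?szl.
have phi_inj X P : X \in porbits s -> P \in porbits s -> phi X = phi P -> X = P.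
  rewrite -!lP => Ol Pl /eqP; rewrite nth_uniq -?szl ?index_mem //; last first.
    by rewrite (perm_uniq pl') enum_uniq.
  by move/eqP => e; rewrite -(nth_index set0 Ol) e nth_index.
have ps x : porbit s x \in porbits s by apply: imset_f.
have pt x : porbit t x \in porbits t by apply: imset_f.
(* The default [x] is never reached on an orbit, which is nonempty; by [repI] the base point depends
   on the orbit alone. *)
pose rep x (X : {set T}) := odflt x [pick y in X].
have repP u x X : X \in porbits u -> porbit u (rep x X) = X.
  case/imsetP=> z _ ->; rewrite /rep; case: pickP => [y|/(_ z)] /=.
    by rewrite -eq_porbit_mem => /eqP.
  by rewrite porbit_id.
have repI x y X u : X \in porbits u -> rep x X = rep y X.
  case/imsetP=> z _ ->; rewrite /rep; case: pickP => [|/(_ z)] //=.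
  by rewrite porbit_id.
have kP x : exists i, x == (s ^+ i)%g (rep x (porbit s x)).
  have /porbitP[i e] : x \in porbit s (rep x (porbit s x)).
    by rewrite repP ?porbit_id.
  by exists i; rewrite -e.
pose k x := xchoose (kP x).
have kE x : (s ^+ k x)%g (rep x (porbit s x)) = x by apply/esym/eqP/(xchooseP (kP x)).
pose h x := (t ^+ k x)%g (rep x (phi (porbit s x))).
have ph x : porbit t (h x) = phi (porbit s x).
  by rewrite porbit_perm repP // phi_in.
(* Paired cycles have equal length, so two exponents agree on one exactly when they agree on the
   other. *)
have hmod x y i j : ((t ^+ i)%g (rep y (phi (porbit s x))) ==
    (t ^+ j)%g (rep y (phi (porbit s x)))) =
  ((s ^+ i)%g (rep y (porbit s x)) == (s ^+ j)%g (rep y (porbit s x))).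
  by rewrite !permX_eq_mod repP ?phi_in // phi_card // repP.
have hS x : h (s x) = t (h x).
  have e : porbit s (s x) = porbit s x by have := porbit_perm s 1 x; rewrite expg1.
  rewrite /h e (repI _ x _ _ (phi_in _ (ps x))) -permM -expgSr.
  apply/eqP; rewrite hmod expgSr permM kE.
  by rewrite -{2}(kE (s x)) e (repI (s x) x _ _ (ps x)).
have hI : injective h.
  move=> x y e; have exy : porbit s x = porbit s y.
    by apply: phi_inj => //; rewrite -!ph e.
  move/eqP: e; rewrite /h exy (repI x y _ _ (phi_in _ (ps y))) hmod.
  by rewrite kE -(repI x y _ _ (ps y)) -exy kE => /eqP.
exists (perm hI); apply/permP => y; rewrite -(permKV (perm hI) y) permJ.
by rewrite !permE hS.
Qed.

(** Inversion keeps the orbits, hence the cycle lengths. *)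
Lemma perm_conjV s : exists h, (s ^ h)%g = s^-1%g.
Proof. by apply: cycle_sizes_conj; rewrite /cycle_sizes porbitsV. Qed.

Lemma sumn_cycle_sizes s : sumn (cycle_sizes s) = #|T|.
Proof.
have -> : #|T| = #|cover (porbits s)|.
  rewrite -cardsT; congr #|pred_of_set _|; apply/esym/setP => x; rewrite inE.
  by apply/bigcupP; exists (porbit s x); rewrite ?imset_f ?porbit_id.
have /eqP <- : trivIset (porbits s).
  apply/trivIsetP => _ _ /imsetP[x _ ->] /imsetP[y _ ->] nxy.
  apply/pred0P => z /=; apply/andP => -[]; rewrite -!eq_porbit_mem => /eqP ex /eqP ey.
  by case/eqP: nxy; rewrite -ex.
by rewrite sumnE big_map -big_enum.
Qed.

Lemma cycle_sizes_gt0 s : all (leq 1) (cycle_sizes s).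
Proof.
apply/allP => c /mapP[X]; rewrite mem_enum => /imsetP[x _ ->] ->.
by rewrite lt0n card_porbit_neq0.
Qed.

End SymmetricGroupConjugacy.

(** * Partitions with prescribed parts *)

Lemma size_le_sumn (s : seq nat) : all (leq 1) s -> (size s <= sumn s)%N.
Proof.
elim: s => //= a s IH /andP[a0 s0]; rewrite -add1n leq_add ?IH //.
Qed.

Lemma mem_le_sumn (s : seq nat) x : x \in s -> (x <= sumn s)%N.
Proof.
elim: s => //= a s IH; rewrite inE => /predU1P[->|/IH]; first exact: leq_addr.
by move/leq_trans; apply; rewrite leq_addl.
Qed.

Lemma geq_trans : transitive geq.
Proof. by move=> a b c /= ab ca; apply: leq_trans ca ab. Qed.

(** The list is sorted and padded with zeros to length [n]; because of the sorting it is recovered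
    only up to order. *)
Lemma npartition_of_parts n (s : seq nat) : all (leq 1) s -> sumn s = n ->
  exists la : npartition n, perm_eq (parts la) s.
Proof.
move=> s0 sn; have szs : (size s <= n)%N by rewrite -sn size_le_sumn.
pose L := sort geq s ++ nseq (n - size s) 0%N.
have szL : size [seq inord x : 'I_n.+1 | x <- L] == n.
  by rewrite size_map size_cat size_sort size_nseq subnKC.
have ltL x : x \in L -> (x < n.+1)%N.
  rewrite mem_cat mem_sort mem_nseq ltnS => /orP[/mem_le_sumn|/andP[_ /eqP->//]].
  by rewrite sn.
have eL : [seq val x | x <- [seq inord x : 'I_n.+1 | x <- L]] = L.
  rewrite -map_comp -[RHS]map_id; apply/eq_in_map => x xL /=.
  by rewrite inordK ?ltL.
have H : sorted geq [seq val x | x <- Tuple szL] &&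
    (\sum_(x <- Tuple szL) val x == n)%N.
  apply/andP; split; last first.
    rewrite -(big_map val xpredT id) /= eL -sumnE sumn_cat sumn_nseq mul0n addn0.
    by rewrite -sn; apply/eqP/perm_sumn; rewrite perm_sort.
  rewrite /= eL (sorted_pairwise geq_trans) pairwise_cat -!(sorted_pairwise geq_trans).
  rewrite sort_sorted; last by move=> a b; apply: leq_total.
  apply/and3P; split=> //.
    by apply/allrelP => a b _; rewrite mem_nseq => /andP[_ /eqP->].
  by elim: (_ - _)%N => // -[|m] IH //=.
exists (exist _ (Tuple szL) H); rewrite /parts /= eL filter_cat filter_nseq cats0.
rewrite (all_filterP _); first by rewrite perm_sort.
by rewrite all_sort.
Qed.

(** * Tableaux *)

Section Tableaux.
Variable n : nat.
Implicit Types (la mu : npartition n) (t : 'I_n -> nat * nat).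

Lemma is_tableau_perm la t (g : {perm 'I_n}) :
  is_tableau la t -> is_tableau la (t \o g).
Proof.
case=> tI [tin tsurj]; split; first exact: inj_comp tI (@perm_inj _ g).
split=> [i|r c /tsurj[i <-]]; first exact: tin.
by exists (g^-1%g i); rewrite /= permKV.
Qed.

(* The potential la_r - c is positive exactly on the diagram of la, which is
   therefore the unique set of cells with its row sizes of least total column
   index. *)
Lemma tableau_row_col_perm la t (t' : 'I_n -> nat * nat) :
  is_tableau la t -> (\sum_i (t' i).2 <= \sum_i (t i).2)%N ->
  injective (fun i => ((t i).1, (t' i).2)) ->
  exists v : {perm 'I_n}, forall j, (t (v j)).1 = (t j).1 /\ (t' (v j)).2 = (t j).2.
Proof.
move=> [tI [tin tsurj]] le_col phiI; set phi := fun i => _ in phiI.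
pose k (x : nat * nat) := (nth 0 (parts la) x.1 - x.2)%N.
(* On the cells [t i], [k] plus the column is exactly the row length; on the cells [phi i] it is at
   least that, since the subtraction truncates. *)
have le_k : (\sum_i k (t i) <= \sum_i k (phi i))%N.
  rewrite -(leq_add2r (\sum_i (t i).2)).
  apply: (@leq_trans (\sum_i k (phi i) + \sum_i (t' i).2)); last by rewrite leq_add2l.
  rewrite -!big_split; apply: leq_sum => i _; rewrite /k /=.
  by move: (tin i); lia.
have phi_onto j : exists i, phi i == t j.
  apply/existsP; apply: contraT => /existsPn nj.
  move: le_k; rewrite leqNgt => /negP[].
  (* [u i] is the label that [t] puts in the cell [phi i] when this lies in the diagram. If the cell
     [t j] were missed, the positive terms for [phi] would inject into the terms for [t] other than
     that of [j], which is itself positive. *)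
  pose u i := odflt i [pick x | t x == phi i].
  have uE i : (0 < k (phi i))%N -> t (u i) = phi i.
    rewrite subn_gt0 => /tsurj[x ex]; rewrite /u; case: pickP => [y /eqP//|/(_ x)].
    by rewrite ex -surjective_pairing eqxx.
  rewrite (bigID (fun i => 0 < k (phi i))%N) /= addnC big1 ?add0n; last first.
    by move=> i; rewrite lt0n negbK => /eqP.
  rewrite (eq_bigr (fun i => k (t (u i)))); last by move=> i /uE->.
  pose P := [set i | 0 < k (phi i)]%N.
  rewrite (eq_bigl (mem P)); last by move=> i; rewrite /= inE.
  rewrite -(big_imset (fun x => k (t x))) /=; last first.
    move=> x y; rewrite !inE => /uE ex /uE ey exy; apply: phiI.
    by rewrite -[LHS]ex exy ey.
  rewrite [ltnRHS](bigD1 j) //=.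
  apply: (@leq_ltn_trans (\sum_(i < n | i != j) k (t i))); last first.
    by rewrite -[ltnLHS]add0n ltn_add2r subn_gt0.
  rewrite big_mkcond [leqRHS]big_mkcond; apply: leq_sum => i _.
  case: ifP => //; case/imsetP=> x; rewrite inE => /uE ex ->.
  case: eqP => //= ej; case/eqP: (nj x).
  by rewrite -ex ej.
pose v j := xchoose (phi_onto j).
have vE j : phi (v j) = t j by apply/eqP/(xchooseP (phi_onto j)).
have vI : injective v by move=> x y e; apply: tI; rewrite -!vE e.
by exists (perm vI) => j; rewrite permE; have := vE j; rewrite /phi; case: (t j) => a b [].
Qed.

Lemma parts_sorted la : sorted geq (parts la).
Proof.
case/andP: (valP la) => so _; exact: sorted_filter geq_trans _ _ so.
Qed.

Lemma parts_gt0 la : all (leq 1) (parts la).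
Proof. exact: filter_all. Qed.

Lemma sumn_parts la : sumn (parts la) = n.
Proof.
case/andP: (valP la) => _ /eqP so; rewrite -[RHS]so -(big_map val xpredT id) /=.
rewrite -sumnE /parts; elim: [seq _ | _ <- _] => //= a s <-.
by case: a.
Qed.

Lemma parts_inj : injective (@parts n).
Proof.
move=> la mu e; apply/val_inj/val_inj/(inj_map val_inj).
have cat_zeros (nu : npartition n) :
    perm_eq [seq val x | x <- val nu] (parts nu ++ nseq (n - size (parts nu)) 0%N).
  rewrite -(perm_filterC (fun x => 0 < x)%N) perm_cat2l.
  set s := filter _ _; have s0 : all (pred1 0%N) s.
    by apply/allP => x; rewrite mem_filter /= lt0n negbK => /andP[].
  rewrite (all_pred1P _ _ s0); suff -> : size s = (n - size (parts nu))%N by [].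
  rewrite !size_filter -[X in (X - _)%N](size_tuple (val nu)).
  by rewrite -(size_map val) -[X in (X - _)%N](count_predC (fun x => 0 < x)%N) addKn.
apply: (sorted_eq geq_trans).
- by move=> a b; rewrite andbC => /anti_leq.
- by case/andP: (valP la).
- by case/andP: (valP mu).
by rewrite (perm_trans (cat_zeros la)) // e perm_sym cat_zeros.
Qed.

Lemma card_tableau_col la t c : is_tableau la t ->
  #|[set i | (t i).2 == c]| = count (fun x => c < x)%N (parts la).
Proof.
move=> [tI [tin tsurj]].
rewrite -[X in count _ X](mkseq_nth 0%N) count_map -size_filter.
rewrite cardE -(size_map (fun i => (t i).1)).
apply/perm_size/uniq_perm.
- rewrite map_inj_in_uniq ?enum_uniq // => i j; rewrite !mem_enum !inE => /eqP ei /eqP ej e.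
  by apply: tI; rewrite (surjective_pairing (t i)) e ei -ej -surjective_pairing.
- by rewrite filter_uniq ?iota_uniq.
move=> r; rewrite mem_filter mem_iota /= add0n.
apply/mapP/andP => [[i]|[/tsurj[i ei] _]]; last first.
  by exists i; rewrite ?mem_enum ?inE ei.
rewrite mem_enum inE => /eqP <- ->; split; first exact: tin.
rewrite ltnNge; apply/negP => h; have := tin i.
by rewrite nth_default.
Qed.

(** Successive differences of these counts are the multiplicities of the parts, and a sorted list is
    determined by its multiset. *)
Lemma parts_eq_of_count la mu :
  (forall c, count (fun x => c < x)%N (parts la) = count (fun x => c < x)%N (parts mu)) ->
  la = mu.
Proof.
move=> e; apply: parts_inj.
apply: (sorted_eq geq_trans); rewrite ?parts_sorted //.
  by move=> a b; rewrite andbC => /anti_leq.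
apply/allP => x _; apply/eqP.
have count_memE (nu : npartition n) :
    (count_mem x (parts nu) + count (fun y => x < y)%N (parts nu))%N =
    count (fun y => x <= y)%N (parts nu).
  by elim: (parts nu) => //= y s <-; move: (count_mem _ _); lia.
case: x count_memE => [|x] cE.
  have c0 (nu : npartition n) : count_mem 0%N (parts nu) = 0%N.
    apply/count_memPn/negP => /(allP (parts_gt0 nu)).
    by [].
  by rewrite !c0.
apply/eqP; rewrite -(eqn_add2r (count (fun y => x.+1 < y)%N (parts la))).
by rewrite cE [in X in _ == X]e cE e.
Qed.

(** The permutation from [tableau_row_col_perm] carries each column of [t] onto the column of [t']
    with the same index, so the column lengths agree. *)
Lemma tableau_shape_eq la mu t t' : is_tableau la t -> is_tableau mu t' ->
  (\sum_i (t' i).2 <= \sum_i (t i).2)%N ->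
  injective (fun i => ((t i).1, (t' i).2)) -> la = mu.
Proof.
move=> tab tab' le_col phiI; apply: parts_eq_of_count => c.
rewrite -(card_tableau_col c tab) -(card_tableau_col c tab').
case: (tableau_row_col_perm tab le_col phiI) => v vP.
rewrite -(card_imset _ (@perm_inj _ v)); apply: eq_card => i.
rewrite -{1}(permKV v i) mem_imset; last exact: perm_inj.
by rewrite !inE -(vP _).2 permKV.
Qed.

Lemma parts_nonincreasing la i j :
  (i <= j)%N -> (nth 0 (parts la) j <= nth 0 (parts la) i)%N.
Proof.
move=> ij; case: (ltnP j (size (parts la))) => [lj|?]; last by rewrite nth_default.
have geqR : reflexive geq by move=> x; apply: leqnn.
by apply: (sorted_leq_nth geq_trans geqR 0%N (parts_sorted la)) => //; apply: leq_ltn_trans lj.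
Qed.

End Tableaux.

(** * Young symmetrizers *)

Definition row_sum (R : realType) n (t : 'I_n -> nat * nat) : galg R {perm 'I_n} :=
  \sum_(s in rowgroup t) delta R s.
Definition col_sum (R : realType) n (t : 'I_n -> nat * nat) : galg R {perm 'I_n} :=
  \sum_(s in colgroup t) (-1) ^+ odd_perm s *: delta R s.
HB.lock Definition young (R : realType) n (t : 'I_n -> nat * nat) :
  galg R {perm 'I_n} := row_sum R t * col_sum R t.

Section YoungSymmetrizers.
Variables (R : realType) (n : nat).
Local Notation A := (galg R {perm 'I_n}).
Implicit Types (la mu : npartition n) (t : 'I_n -> nat * nat) (s g h : {perm 'I_n}).

Lemma rowgroupP t s : reflect (forall i, (t (s i)).1 = (t i).1) (s \in rowgroup t).
Proof. by rewrite inE; apply: (iffP forallP) => h i; apply/eqP; rewrite h. Qed.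

Lemma colgroupP t s : reflect (forall i, (t (s i)).2 = (t i).2) (s \in colgroup t).
Proof. by rewrite inE; apply: (iffP forallP) => h i; apply/eqP; rewrite h. Qed.

Lemma rowgroup_group_set t : group_set (rowgroup t).
Proof.
apply/group_setP; split=> [|s h /rowgroupP sP /rowgroupP hP]; apply/rowgroupP => i.
  by rewrite perm1.
by rewrite permM hP sP.
Qed.

Lemma colgroup_group_set t : group_set (colgroup t).
Proof.
apply/group_setP; split=> [|s h /colgroupP sP /colgroupP hP]; apply/colgroupP => i.
  by rewrite perm1.
by rewrite permM hP sP.
Qed.

Canonical rowgroup_group t := Group (rowgroup_group_set t).
Canonical colgroup_group t := Group (colgroup_group_set t).

Lemma tperm_rowgroup t i j : (t i).1 = (t j).1 -> tperm i j \in rowgroup t.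
Proof. by move=> e; apply/rowgroupP => k; case: tpermP => // ->. Qed.

Lemma tperm_colgroup t i j : (t i).2 = (t j).2 -> tperm i j \in colgroup t.
Proof. by move=> e; apply/colgroupP => k; case: tpermP => // ->. Qed.

Local Notation row_sum := (row_sum R).
Local Notation col_sum := (col_sum R).
Local Notation young := (young R).

Lemma youngE t : young t = row_sum t * col_sum t.
Proof. by rewrite young.unlock. Qed.

Lemma young_symE t : young_sym R t = young t.
Proof.
rewrite youngE mulr_suml; apply/ffunP => g; rewrite ffunE sum_ffunE.
apply: eq_bigr => r _; rewrite mulr_sumr sum_ffunE; apply: eq_bigr => c _.
by rewrite -scalerAr deltaM !ffunE mulrC.
Qed.

Lemma gactE s (F : A) : Defs.gact s F = delta R s * F.
Proof. by apply/ffunP => h; rewrite ffunE delta_mulE. Qed.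

Lemma row_sumE t g : row_sum t g = (g \in rowgroup t)%:R.
Proof.
rewrite sum_ffunE; case: (boolP (g \in _)) => gR.
  rewrite (bigD1 g) //= big1 ?addr0 ?ffunE ?eqxx // => s /andP[_ /negPf ne].
  by rewrite ffunE eq_sym ne.
by rewrite big1 // => s sR; rewrite ffunE; case: eqP => // e; rewrite e sR in gR.
Qed.

Lemma col_sumE t g : col_sum t g = (g \in colgroup t)%:R * (-1) ^+ odd_perm g.
Proof.
rewrite sum_ffunE; case: (boolP (g \in _)) => gR.
  rewrite (bigD1 g) //= big1 ?addr0 ?ffunE ?eqxx ?mul1r; last first.
    by move=> s /andP[_ /negPf ne]; rewrite !ffunE eq_sym ne; apply: mulr0.
  exact: mulr1.
rewrite big1 ?mul0r // => s sR; rewrite !ffunE; case: eqP => [e|]; first by rewrite e sR in gR.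
by rewrite scaler0.
Qed.

Lemma delta_row_sum t s : s \in rowgroup t -> delta R s * row_sum t = row_sum t.
Proof.
move=> sR; apply/ffunP => h; rewrite delta_mulE !row_sumE.
by rewrite groupMr ?groupV.
Qed.

Lemma star_row_sum t : star (row_sum t) = row_sum t.
Proof. by apply/ffunP => h; rewrite ffunE !row_sumE groupV. Qed.

Lemma row_sum_sqr t : row_sum t * row_sum t = #|rowgroup t|%:R *: row_sum t.
Proof.
rewrite {1}/row_sum mulr_suml (eq_bigr (fun=> row_sum t)) => [|s sR]; last exact: delta_row_sum.
by rewrite sumr_const scaler_nat.
Qed.

Lemma col_sum_delta t s : s \in colgroup t ->
  col_sum t * delta R s = (-1) ^+ odd_perm s *: col_sum t.
Proof.
move=> sC; apply/ffunP => h; rewrite mul_deltaE ffunE !col_sumE.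
rewrite groupMl ?groupV // odd_permM odd_permV signr_addb.
by rewrite [RHS]mulrCA.
Qed.

Lemma eq_opp_galg (F : A) : F = - F -> F = 0.
Proof.
move=> e; apply/ffunP => h; rewrite ffunE; apply/eqP.
have := congr1 (fun X : A => X h) e; rewrite ffunE => /eqP.
by rewrite eq_sym (eqNr (F h : R)).
Qed.

(** A permutation in both the row and the column group fixes the cell of every label, so only the
    identity contributes. *)
Lemma young1 t : injective t -> young t 1%g = 1.
Proof.
move=> tI; rewrite youngE galgE (bigD1 1%g) //= big1 ?addr0 => [|g ne].
  by rewrite row_sumE col_sumE invg1 mulg1 !group1 odd_perm1 !mulr1.
rewrite row_sumE col_sumE mul1g groupV.
case: rowgroupP => gR; last by rewrite mul0r.
case: colgroupP => gC; last by rewrite mul0r mulr0.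
case/eqP: ne; apply/permP => i; rewrite perm1; apply: tI.
by rewrite (surjective_pairing (t (g i))) gR gC -surjective_pairing.
Qed.

Lemma young_neq0 t : injective t -> young t != 0.
Proof.
move=> tI; apply/eqP => /(congr1 (fun X : A => X 1%g))/eqP.
by rewrite young1 // ffunE oner_eq0.
Qed.

(** The row sum absorbs the transposition of [i] and [j]; moved across [delta R g] it becomes the
    transposition of [g i] and [g j], which the column sum turns into the sign -1. The product is
    thus its own negative. *)
Lemma col_delta_row_eq0 t (t' : 'I_n -> nat * nat) g i j : i != j ->
  (t i).1 = (t j).1 -> (t' (g i)).2 = (t' (g j)).2 ->
  col_sum t' * delta R g * row_sum t = 0.
Proof.
move=> ne er ec; apply: eq_opp_galg.
rewrite -{1}(delta_row_sum (tperm_rowgroup er)) !mulrA -(mulrA _ (delta R g)) deltaM.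
have -> : (tperm i j * g = g * tperm (g i) (g j))%g.
  by rewrite -tpermJ /conjg mulKVg.
rewrite -deltaM !mulrA (col_sum_delta (tperm_colgroup ec)).
by rewrite odd_tperm (inj_eq (@perm_inj _ g)) ne expr1 scaleN1r !mulNr.
Qed.

(** If no two labels shared a row of [t] and a column of [t' \o g], the shapes would agree by
    [tableau_shape_eq]; such a pair kills the middle of the product. Comparing column totals takes
    the place of the dominance order: one of the two directions always holds. *)
Lemma young_delta_young_eq0 la mu t t' g : is_tableau la t -> is_tableau mu t' ->
  la <> mu -> (\sum_i (t' i).2 <= \sum_i (t i).2)%N ->
  young t' * delta R g * young t = 0.
Proof.
move=> tab tab' ne le_col.
have [phiI|] := injectiveP (fun i => ((t i).1, ((t' \o g) i).2)).
  case: ne; apply: (tableau_shape_eq tab (is_tableau_perm g tab') _ phiI).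
  by rewrite [leqLHS](reindex_inj (@perm_inj _ g^-1%g)) /=;
     under eq_bigr do rewrite permKV.
move/injectiveP/injectivePn => [i [j nij [er ec]]].
rewrite !youngE -!mulrA (mulrA (delta R g)) (mulrA (col_sum t')) (mulrA (col_sum t')).
by rewrite (@col_delta_row_eq0 t t' g j i) ?mul0r ?mulr0 // eq_sym.
Qed.

(** A permutation [h] either factors through the column and row groups, so that [F h] is [F 1] up to
    sign, or two labels share a row of [t] and a column of [t \o h^-1], so that [F h = - F h]. *)
Lemma young_unique la t (F : A) : is_tableau la t ->
  (forall s, s \in rowgroup t -> delta R s * F = F) ->
  (forall s, s \in colgroup t -> F * delta R s = (-1) ^+ odd_perm s *: F) ->
  F 1%g = 0 -> F = 0.
Proof.
move=> tab rowF colF F1; apply/ffunP => h; rewrite ffunE.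
have FR s g : s \in rowgroup t -> F (g * s^-1)%g = F g.
  by move=> sR; rewrite -delta_mulE rowF.
have FC s g : s \in colgroup t -> F (s^-1 * g)%g = (-1) ^+ odd_perm s * F g.
  by move=> sC; rewrite -mul_deltaE colF // ffunE.
have [phiI|] := injectiveP (fun i => ((t i).1, ((t \o h^-1%g) i).2)).
  have le_col : (\sum_i ((t \o h^-1%g) i).2 <= \sum_i (t i).2)%N.
    by rewrite [leqLHS](reindex_inj (@perm_inj _ h)) /=;
       under eq_bigr do rewrite permK.
  case: (tableau_row_col_perm tab le_col phiI) => v vP.
  have vR : v \in rowgroup t by apply/rowgroupP => j; case: (vP j).
  have vC : (v * h^-1)%g \in colgroup t.
    by apply/colgroupP => j; rewrite permM; case: (vP j).
  rewrite -(FR v) // -[(h * v^-1)%g]mulg1 -{1}(invgK h) -invMg FC // F1 mulr0 //.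
move/injectiveP/injectivePn => [i [j nij [er ec]]].
have tR : tperm i j \in rowgroup t by rewrite tperm_rowgroup.
have tC : tperm (h^-1%g i) (h^-1%g j) \in colgroup t by rewrite tperm_colgroup.
apply/eqP; rewrite -(eqNr (F h : R)); apply/eqP.
rewrite -[RHS](FR _ h tR) tpermV.
have -> : (h * tperm i j = (tperm (h^-1 i) (h^-1 j))^-1 * h)%g.
  by rewrite tpermV -tpermJ /conjg invgK mulgA mulgKV.
by rewrite FC // odd_tperm (inj_eq (@perm_inj _ h^-1%g)) nij mulN1r.
Qed.

Lemma delta_young t s : s \in rowgroup t -> delta R s * young t = young t.
Proof. by move=> sR; rewrite youngE mulrA delta_row_sum. Qed.

Lemma young_delta t s : s \in colgroup t ->
  young t * delta R s = (-1) ^+ odd_perm s *: young t.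
Proof. by move=> sC; rewrite youngE -mulrA col_sum_delta // scalerAr. Qed.

(** The difference of the two sides satisfies the hypotheses of [young_unique], as the Young
    symmetrizer has coefficient 1 at the identity. *)
Lemma young_sandwich la t (F : A) : is_tableau la t ->
  young t * F * young t = (young t * F * young t) 1%g *: young t.
Proof.
move=> tab; set X := young t * F * young t.
have rX s : s \in rowgroup t -> delta R s * X = X.
  by move=> sR; rewrite /X !mulrA delta_young.
have cX s : s \in colgroup t -> X * delta R s = (-1) ^+ odd_perm s *: X.
  by move=> sC; rewrite /X -mulrA young_delta // -scalerAr.
apply/eqP; rewrite -subr_eq0; apply/eqP.
apply: (young_unique tab) => [s sR|s sC|].
- by rewrite mulrBr -scalerAr delta_young // rX.
- by rewrite mulrBl -scalerAl young_delta // cX // scalerBr !scalerA mulrC.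
rewrite !ffunE young1; last by case: tab.
by apply/eqP; rewrite subr_eq0; apply/eqP/esym/mulr1.
Qed.

(** Semiprimeness gives a [G] for which [young t * G * X] is nonzero; by [young_sandwich] it is a
    multiple of [young t], and rescaling recovers the generator. *)
Lemma young_left_ideal_simple la t (F : A) : is_tableau la t ->
  F * young t != 0 -> exists G : A, G * (F * young t) = young t.
Proof.
move=> tab; set X := F * young t => X0.
have XE G : young t * G * X = (young t * G * X) 1%g *: young t.
  by rewrite /X !mulrA -(mulrA _ G); apply: young_sandwich tab.
have [[G G0]|G0] := pselect (exists G : A, (young t * G * X) 1%g != 0).
  exists (((young t * G * X) 1%g)^-1 *: (young t * G)).
  by rewrite -scalerAl [X in _ *: X]XE scalerA (@mulVf R) ?scale1r.
case/eqP: X0; apply: galg_semiprime => G.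
have -> : X * G * X = F * (young t * G * X) by rewrite /X !mulrA.
rewrite XE; case: (eqVneq ((young t * G * X) 1%g) 0) => [->|ne].
  by rewrite scale0r mulr0.
by case: G0; exists G.
Qed.
End YoungSymmetrizers.

(** * The center of the group algebra *)

Lemma cycle_type_exists n : exists ct : {perm 'I_n} -> npartition n,
  forall s t, ct s = ct t -> exists h, (s ^ h)%g = t.
Proof.
have ex (s : {perm 'I_n}) : exists la : npartition n, perm_eq (parts la) (cycle_sizes s).
  by apply: npartition_of_parts; rewrite ?cycle_sizes_gt0 // sumn_cycle_sizes card_ord.
exists (fun s => xchoose (ex s)) => s t e; apply: cycle_sizes_conj.
rewrite -(permPl (xchooseP (ex s))) e.
exact: (xchooseP (ex t)).
Qed.

(** Central elements are class functions, and every permutation is conjugate to its inverse. *)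
Lemma galg_class_star (R : realType) n (F : galg R {perm 'I_n}) :
  (forall s, delta R s * F = F * delta R s) -> star F = F.
Proof.
move=> FC; apply/ffunP => g; rewrite ffunE.
by have [h <-] := perm_conjV g; apply: galg_central_class.
Qed.

(* There is at most one conjugacy class per cycle type, so the center has at most
   as many dimensions as there are partitions. *)
Lemma center_spanned (R : realType) n (z : npartition n -> galg R {perm 'I_n}) :
  (forall la s, delta R s * z la = z la * delta R s) ->
  (forall b : npartition n -> R, \sum_la b la *: z la = 0 -> forall la, b la = 0) ->
  forall F : galg R {perm 'I_n}, (forall s, delta R s * F = F * delta R s) ->
  exists b : npartition n -> R, F = \sum_la b la *: z la.
Proof.
move=> zC zfree F FC; have [ct ctP] := cycle_type_exists n.
pose m := #|{: npartition n}|.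
(* The value of a class function on the permutations whose type has index [j], or 0 if [ct] does not
   take that value. *)
pose val (G : galg R {perm 'I_n}) (j : 'I_m) : R :=
  if [pick g | ct g == enum_val j] is Some g then G g else 0.
have valE (G : galg R {perm 'I_n}) g : (forall s, delta R s * G = G * delta R s) ->
    G g = val G (enum_rank (ct g)).
  move=> GC; rewrite /val enum_rankK; case: pickP => [h /eqP eh|/(_ g)]; last by rewrite eqxx.
  by have [x <-] := ctP _ _ eh; apply: galg_central_class.
pose M : 'M[R]_m := \matrix_(i, j) val (z (enum_val i)) j.
have sumE (v : 'rV[R]_m) g :
    (\sum_la v 0 (enum_rank la) *: z la) g = (v *m M) 0 (enum_rank (ct g)).
  rewrite sum_ffunE mxE [RHS](reindex enum_rank) /=; last exact: onW_bij (enum_rank_bij _).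
  by apply: eq_bigr => la _; rewrite ffunE mxE enum_rankK -valE.
(* Freeness of the [z la] makes the square matrix of their values invertible; solving with the
   values of [F] then gives the coefficients. *)
have Mu : M \in unitmx.
  rewrite -row_free_unit; apply: inj_row_free => v vM.
  have z0 : \sum_la v 0 (enum_rank la) *: z la = 0.
    by apply/ffunP => g; rewrite sumE vM mxE ffunE.
  by apply/rowP => i; rewrite -[i]enum_valK (zfree _ z0) mxE.
exists (fun la => ((\row_j val F j) *m invmx M) 0 (enum_rank la)).
by apply/ffunP => g; rewrite sumE mulmxKV // mxE -valE.
Qed.

(** * Central idempotents and 1 as a combination of squares *)

Section Idempotents.
Variables (R : realType) (n : nat) (tau : npartition n -> 'I_n -> nat * nat).
Hypothesis htau : forall la, is_tableau la (tau la).
Local Notation A := (galg R {perm 'I_n}).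

Let c la : A := young R (tau la).
Let z la : A := conj_sum (c la).

Let zC la (F : A) : F * z la = z la * F.
Proof. exact/galg_central/conj_sum_central. Qed.

(** [young_delta_young_eq0] needs the column totals in one order; in the other order the central
    factor is first moved to the right. *)
Lemma conj_sum_young_young la mu : la <> mu ->
  conj_sum (young R (tau mu)) * young R (tau la) = 0.
Proof.
move=> ne.
have [le|/ltnW le] := leqP (\sum_i (tau mu i).2) (\sum_i (tau la i).2).
  apply: conj_sum_eq0r => g.
  exact: (young_delta_young_eq0 R g (htau la) (htau mu) ne le).
rewrite -zC; apply: conj_sum_eq0l => g.
by apply: (young_delta_young_eq0 R g (htau mu) (htau la)) => // /esym.
Qed.

Let zz0 la mu : la <> mu -> z mu * z la = 0.
Proof.
move=> ne; rewrite mulr_sumr big1 // => g _.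
by rewrite !mulrA -zC -(mulrA _ (z mu)) conj_sum_young_young // mulr0 mul0r.
Qed.

Let z_neq0 la : z la != 0.
Proof.
apply/eqP => /(congr1 (fun X : A => X 1%g))/eqP.
rewrite conj_sum1 young1; last by case: (htau la).
rewrite mulr1 ffunE pnatr_eq0 => /eqP/card0_eq/(_ 1%g).
by [].
Qed.

Let z_star la : star (z la) = z la.
Proof. by apply: galg_class_star => s; rewrite conj_sum_central. Qed.

(** Multiplying a relation by [z la] leaves [b la *: (z la * z la)], and [z la], self-adjoint and
    nonzero, has a nonzero square. *)
Lemma center_young (F : A) : (forall s, delta R s * F = F * delta R s) ->
  exists b : npartition n -> R, F = \sum_la b la *: conj_sum (young R (tau la)).
Proof.
apply: center_spanned => [la s|b b0 la]; first exact: conj_sum_central.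
have : z la * (\sum_mu b mu *: z mu) = 0 by rewrite b0 mulr0.
rewrite mulr_sumr (bigD1 la) //= big1 => [|mu ne]; last first.
  by rewrite -scalerAr zz0 ?scaler0 //; apply/eqP.
rewrite addr0 -scalerAr => /eqP; rewrite scaler_eq0 => /orP[/eqP//|/eqP zz].
have /eqP[] := z_neq0 la; apply: star_mul_eq0.
by rewrite z_star.
Qed.

Lemma one_sum_star_squares : exists (k b : npartition n -> R),
  (forall la, 0 <= k la) /\
  let x la g := row_sum R (tau la) * delta R g * (b la *: conj_sum (young R (tau la))) in
  1 = \sum_la k la *: \sum_g star (x la g) * x la g.
Proof.
have [|b b1] := @center_young 1; first by move=> s; rewrite mulr1 mul1r.
have [e eE] : exists e : npartition n -> A, forall la, e la = b la *: z la.
  by exists (fun la => b la *: z la).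
have eC la (F : A) : F * e la = e la * F by rewrite eE -scalerAr zC scalerAl.
(* Of the decomposition of 1, only the term [e la] survives multiplication by [c la], and likewise
   by [z la] below. *)
have ec la : e la * c la = c la.
  rewrite -[RHS]mul1r b1 mulr_suml (bigD1 la) //= big1 ?addr0 ?eE // => mu ne.
  by rewrite -scalerAl conj_sum_young_young ?scaler0 //; apply/nesym/eqP.
have ze la : z la * e la = z la.
  rewrite -[RHS]mulr1 b1 mulr_sumr (bigD1 la) //= big1 ?addr0 ?eE // => mu ne.
  by rewrite -scalerAr zz0 ?scaler0 //; apply/eqP.
have ee la : e la * e la = e la by rewrite {1 3}eE -scalerAl ze.
have es la : star (e la) = e la by rewrite eE linearZ /= z_star.
have c0 la : c la != 0 by apply: young_neq0; case: (htau la).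
have b0 la : b la != 0.
  by apply: contra_neq (c0 la) => bla; rewrite -ec eE bla scale0r mul0r.
have key la : exists2 a : R, 0 < a & conj_sum (row_sum R (tau la)) * e la = a *: e la.
  set r := row_sum R (tau la); set y := _ * e la.
  have [|a ya] := @center_young y.
    by move=> s; rewrite mulrA conj_sum_central -!mulrA eC.
  (* [y] lies in the span of the [z mu]; multiplying by [e la], which fixes [y], keeps only the term
     of [la]. *)
  have ye : y = (a la / b la) *: e la.
    rewrite eE scalerA mulfVK // -(ze la) scalerAl.
    have -> : y = y * e la by rewrite /y -mulrA ee.
    rewrite ya mulr_suml (bigD1 la) //= big1 ?addr0 // => mu ne.
    by rewrite -scalerAl eE -scalerAr zz0 ?scaler0 //; apply/nesym/eqP.
  exists (a la / b la) => //.
  have e1 : 0 < (e la 1%g : R).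
    rewrite -ee -{1}es star_mul1_gt0 //.
    by apply: contra_neq (c0 la) => e0; rewrite -ec e0 mul0r.
  have R0 : 0 < #|rowgroup (tau la)|%:R :> R by rewrite ltr0n cardG_gt0.
  (* A positive multiple of [r * e la] is [star (r * e la) * (r * e la)], and [r * e la] is nonzero
     because right multiplication by the column sum turns it into [c la]. *)
  have re1 : 0 < ((r * e la) 1%g : R).
    rewrite -(pmulr_rgt0 _ R0).
    have -> : #|rowgroup (tau la)|%:R * (r * e la) 1%g = (star (r * e la) * (r * e la)) 1%g.
      rewrite starM star_row_sum es -mulrA (mulrA r) row_sum_sqr -scalerAl -scalerAr.
      by rewrite -eC -mulrA ee [RHS]ffunE.
    rewrite star_mul1_gt0 //; apply: contra_neq (c0 la) => re0.
    by rewrite -ec -eC /c youngE -mulrA eC mulrA re0 mul0r.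
  have y1 : y 1%g = #|{perm 'I_n}|%:R * (r * e la) 1%g.
    by rewrite /y -conj_sumMr // conj_sum1.
  have : 0 < (y 1%g : R).
    by rewrite y1 mulr_gt0 // ltr0n; apply/card_gt0P; exists 1%g.
  by rewrite ye ffunE [X in 0 < X](_ : _ = (a la / b la) * e la 1%g) // pmulr_lgt0.
have /choice[a aP] la : exists a : R, 0 < a /\
    conj_sum (row_sum R (tau la)) * e la = a *: e la.
  by have [a] := key la; exists a.
(* The scalar undoes the factor [#|rowgroup (tau la)|] from squaring the row sum and the factor
   [a la] from summing its conjugates. *)
exists (fun la => (#|rowgroup (tau la)|%:R * a la)^-1), b; split=> [la|x].
  by rewrite invr_ge0 mulr_ge0 ?ler0n //; case: (aP la) => /ltW.
rewrite b1; apply: eq_bigr => la _; rewrite -/(z la) -eE.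
have [a0 ya] := aP la.
have -> : \sum_g star (x la g) * x la g =
    #|rowgroup (tau la)|%:R *: (conj_sum (row_sum R (tau la)) * e la).
  rewrite mulr_suml scaler_sumr; apply: eq_bigr => g _.
  have -> : x la g = row_sum R (tau la) * delta R g * e la by rewrite eE.
  rewrite !starM star_row_sum es star_delta -(mulrA (e la)) -eC -!mulrA ee.
  by rewrite (mulrA (row_sum _ _)) row_sum_sqr -scalerAl -scalerAr.
by rewrite ya !scalerA -mulrA mulVf ?scale1r // mulf_neq0 ?gt_eqF // ltr0n cardG_gt0.
Qed.
End Idempotents.

(** * The action on functions *)

Section GraphFunctions.
Variables (R : realType) (n : nat).
Local Notation A := (galg R {perm 'I_n}).
Implicit Types (f u v : fn R n) (F G : A) (s t : {perm 'I_n}).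

Fact edge_act_subproof s (e : edge n) : #|s @: val e| == 2.
Proof. by rewrite card_imset ?(valP e) //; apply: perm_inj. Qed.

Definition edge_act s (e : edge n) : edge n := Sub (s @: val e) (edge_act_subproof s e).

Lemma edge_act1 e : edge_act 1 e = e.
Proof. by apply: val_inj; rewrite /= (eq_imset _ (@perm1 _)) imset_id. Qed.

Lemma edge_actM s t e : edge_act (t * s)%g e = edge_act s (edge_act t e).
Proof.
by apply: val_inj; rewrite /= -imset_comp; apply: eq_imset => i; rewrite permM.
Qed.

Lemma edge_act_inj s : injective (edge_act s).
Proof.
by move=> e e' /(congr1 val)/(imset_inj (@perm_inj _ s)) /val_inj.
Qed.

Lemma pactE s f (x : point n) : pact s f x = f (edge_act s @^-1: x).
Proof.
rewrite ffunE; congr (f _); apply/setP => e; rewrite !inE.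
apply/existsP/idP => [[e' /andP[xe' /eqP ee']]|xe].
  by rewrite (_ : edge_act s e = e') //; apply: val_inj; rewrite ee'.
by exists (edge_act s e); rewrite xe /=.
Qed.

Lemma pact_is_linear s : linear (@pact R n s).
Proof. by move=> a f g; apply/ffunP => x; rewrite !(ffunE, pactE). Qed.

HB.instance Definition _ s :=
  GRing.isLinear.Build R (fn R n) (fn R n) _ (@pact R n s) (pact_is_linear s).

Lemma pact1 f : pact 1 f = f.
Proof.
apply/ffunP => x; rewrite pactE; congr (f _).
by apply/setP => e; rewrite inE edge_act1.
Qed.

Lemma pactM s t f : pact (t * s)%g f = pact s (pact t f).
Proof.
apply/ffunP => x; rewrite !pactE; congr (f _).
by apply/setP => e; rewrite !inE edge_actM.
Qed.

Lemma pact_fmul s f g : pact s (fmul f g) = fmul (pact s f) (pact s g).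
Proof. by apply/ffunP => x; rewrite pactE [LHS]ffunE [RHS]ffunE !pactE. Qed.

Lemma pact_mono s S : pact s (mono R S) = mono R (edge_act s @: S).
Proof. by apply/ffunP => x; rewrite pactE !ffunE sub_imset_pre. Qed.

Lemma deg_le0 d : deg_le d (0 : fn R n).
Proof. by exists (fun=> 0); rewrite big1 // => S _; rewrite scale0r. Qed.

Lemma deg_leD d u v : deg_le d u -> deg_le d v -> deg_le d (u + v).
Proof.
move=> [c ->] [c' ->]; exists (fun S => c S + c' S).
by rewrite -big_split; apply: eq_bigr => S _; rewrite scalerDl.
Qed.

Lemma deg_leZ d a u : deg_le d u -> deg_le d (a *: u).
Proof.
move=> [c ->]; exists (fun S => a * c S).
by rewrite scaler_sumr; apply: eq_bigr => S _; rewrite scalerA.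
Qed.

Lemma deg_le_sum d (I : finType) (P : pred I) (u : I -> fn R n) :
  (forall i, P i -> deg_le d (u i)) -> deg_le d (\sum_(i | P i) u i).
Proof. by move=> h; apply: big_ind => //; [exact: deg_le0 | exact: deg_leD]. Qed.

Lemma deg_le_mono d (S : {set edge n}) : (#|S| <= d)%N -> deg_le d (mono R S : fn R n).
Proof.
move=> Sd; exists (fun S' => (S' == S)%:R).
rewrite (bigD1 S) //= big1 ?addr0 ?eqxx ?scale1r // => S' /andP[_ /negPf->].
by rewrite scale0r.
Qed.

Lemma deg_le_pact d s u : deg_le d u -> deg_le d (pact s u).
Proof.
move=> [c ->]; rewrite linear_sum; apply: deg_le_sum => S Sd.
rewrite linearZ /= pact_mono; apply/deg_leZ/deg_le_mono.
by rewrite card_imset //; apply: edge_act_inj.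
Qed.

(** The linear extension of [pact] to the group algebra. The algebra element comes last so that
    [aact u] is a linear map, later restricted to a Specht module. *)
Definition aact u (F : ga R n) : fn R n := \sum_g F g *: pact g u.

Lemma aact_is_linear u : linear (aact u).
Proof.
move=> a F G; rewrite scaler_sumr -big_split; apply: eq_bigr => g _.
by rewrite !ffunE scalerDl scalerA.
Qed.

HB.instance Definition _ u :=
  GRing.isLinear.Build R (ga R n) (fn R n) _ (aact u) (aact_is_linear u).

Lemma aact_suml (I : finType) (P : pred I) (c : I -> R) (w : I -> fn R n) F :
  aact (\sum_(i | P i) c i *: w i) F = \sum_(i | P i) c i *: aact (w i) F.
Proof.
rewrite /aact; under [RHS]eq_bigr => i _ do rewrite scaler_sumr.
rewrite [RHS]exchange_big; apply: eq_bigr => g _ /=.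
rewrite linear_sum scaler_sumr; apply: eq_bigr => i _.
by rewrite linearZ !scalerA mulrC.
Qed.

Lemma aact_delta u s : aact u (delta R s) = pact s u.
Proof.
rewrite /aact (bigD1 s) //= big1 ?addr0 ?ffunE ?eqxx ?scale1r // => g /negPf ne.
by rewrite ffunE ne scale0r.
Qed.

Lemma aact1 u : aact u (1 : A) = u.
Proof. by rewrite -delta1 aact_delta pact1. Qed.

Lemma aact0 F : aact 0 F = 0.
Proof. by rewrite /aact big1 // => g _; rewrite linear0 scaler0. Qed.

Lemma aactM u F G : aact u (F * G) = aact (aact u G) F.
Proof.
rewrite galg_act [LHS]linear_sum; apply: eq_bigr => g _.
rewrite [LHS]linearZ /=; congr (_ *: _).
rewrite linear_sum {1}/aact [LHS](reindex_inj (mulIg g)).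
by apply: eq_bigr => h _; rewrite delta_mulE mulgK linearZ pactM.
Qed.

Lemma deg_le_act d u F : deg_le d u -> deg_le d (aact u F).
Proof. by move=> ud; apply: deg_le_sum => g _; apply/deg_leZ/deg_le_pact. Qed.

Lemma fmulC f g : fmul f g = fmul g f.
Proof. by apply/ffunP => x; rewrite !ffunE mulrC. Qed.

Lemma fmul_is_linear f : linear (fmul f).
Proof. by move=> a u v; apply/ffunP => x; rewrite !ffunE mulrDr; congr (_ + _); apply: mulrCA. Qed.

HB.instance Definition _ f :=
  GRing.isLinear.Build R (fn R n) (fn R n) _ (fmul f) (fmul_is_linear f).

Lemma sym_is_linear : linear (@sym R n).
Proof.
move=> a f g; rewrite /sym scalerA mulrC -scalerA -scalerDr; congr (_ *: _).
by rewrite scaler_sumr -big_split; apply: eq_bigr => s _; rewrite linearP.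
Qed.

HB.instance Definition _ :=
  GRing.isLinear.Build R (fn R n) (fn R n) _ (@sym R n) sym_is_linear.

Lemma sym_pact s f : sym (pact s f) = sym f.
Proof.
rewrite /sym; congr (_ *: _); rewrite [RHS](reindex_inj (mulgI s)).
by apply: eq_bigr => t _; rewrite pactM.
Qed.

Lemma sym_id f : Sn_invariant f -> sym f = f.
Proof.
move=> fI; rewrite /sym (eq_bigr (fun=> f)) => [|s _]; last exact: fI.
rewrite sumr_const card_Sn -scaler_nat scalerA mulVf ?scale1r //.
by rewrite pnatr_eq0 -lt0n fact_gt0.
Qed.

(** Since [sym] ignores a common translation of both factors, [g] acting on one of them can be
    traded for its inverse acting on the other. *)
Lemma sym_act_adjoint u v F :
  sym (fmul (aact u F) v) = sym (fmul u (aact v (star F))).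
Proof.
rewrite fmulC /aact !linear_sum /= (reindex_inj invg_inj); apply: eq_bigr => g _ /=.
rewrite !linearZ /= ffunE; congr (_ *: _).
by rewrite -(sym_pact g) pact_fmul -pactM mulVg pact1 fmulC.
Qed.

Lemma sym_fmul_star u F :
  sym (fmul (aact u (star F * F)) u) = sym (fmul (aact u F) (aact u F)).
Proof. by rewrite aactM sym_act_adjoint starK. Qed.

End GraphFunctions.

(** * Isotypic components *)

Section Isotypic.
Variables (R : realType) (n d : nat).
Local Notation A := (galg R {perm 'I_n}).
Implicit Types (la : npartition n) (u v : fn R n) (F G : A) (t : 'I_n -> nat * nat).

Lemma spechtP t (x : ga R n) :
  reflect (exists F : A, x = F * young R t) (x \in specht R t).
Proof.
apply: (iffP idP) => [|[F ->]].
  rewrite /specht; set X := [seq _ | _ <- _] => xX.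
  rewrite (coord_span (X := in_tuple X) xX).
  apply: (big_ind (fun x => exists F : A, x = F * young R t)) => [|_ _ [F ->] [G ->]|i _].
    by exists 0; rewrite mul0r.
    by exists (F + G); rewrite mulrDl.
  have /mapP[s _ ->] := mem_nth 0 (ltn_ord i : (i < size X)%N).
  by exists (coord (in_tuple X) i x *: delta R s); rewrite gactE young_symE -scalerAl.
rewrite galg_act; apply: memv_suml => g _; apply/memvZ/memv_span.
by apply/mapP; exists g; rewrite ?mem_enum // gactE young_symE.
Qed.

Lemma isotypic0 t : isotypic d t (0 : fn R n).
Proof. by exists 0%N, (fun=> 0); split=> [|[]//]; rewrite big_ord0. Qed.

Lemma isotypicD t u v : isotypic d t u -> isotypic d t v -> isotypic d t (u + v).
Proof.
move=> [m [us [-> usP]]] [m' [vs [-> vsP]]].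
exists (m + m')%N, (fun i => match split i with inl j => us j | inr j => vs j end).
split=> [|i]; last by case: (split i).
rewrite big_split_ord /=; congr (_ + _); apply: eq_bigr => i _.
  by case: split_ordP => j; [move/lshift_inj-> | move/eqP; rewrite eq_lrshift].
by case: split_ordP => j; [move/eqP; rewrite eq_rlshift | move/rshift_inj->].
Qed.

(** [aact u] commutes with left multiplication, and its kernel meets the simple left ideal of the
    Young symmetrizer trivially once the generator survives. *)
Lemma iso_submod_image la t u : is_tableau la t -> deg_le d u ->
  aact u (young R t) != 0 -> iso_submod d t (linfun (aact u) @: specht R t)%VS.
Proof.
move=> tab ud u0; split; [|split].
- by move=> v /memv_imgP[x _ ->]; rewrite lfunE; apply: deg_le_act.
- move=> s v /memv_imgP[x /spechtP[F ->] ->]; rewrite lfunE /=.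
  rewrite -aact_delta -aactM mulrA; apply/memv_imgP.
  exists (delta R s * F * young R t : A); rewrite ?lfunE //.
  by apply/spechtP; exists (delta R s * F).
exists (linfun (aact u)); split=> //; split.
  apply/eqP; rewrite -subv0; apply/subvP => x; rewrite memv_cap memv_ker memv0.
  rewrite lfunE => /andP[/eqP /= x0 /spechtP[F ex]].
  apply: contraT; rewrite {1}ex => /(young_left_ideal_simple tab)[G eG].
  by case/eqP: u0; rewrite -eG -ex aactM x0 aact0.
by move=> s x _; rewrite !lfunE /= gactE aactM aact_delta.
Qed.

Lemma isotypic_aact la t u F : is_tableau la t -> deg_le d u ->
  isotypic d t (aact u (F * young R t)).
Proof.
move=> tab ud; have [u0|u0] := eqVneq (aact u (young R t)) 0.
  by rewrite aactM u0 aact0; apply: isotypic0.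
exists 1%N, (fun=> aact u (F * young R t)); rewrite big_ord1; split=> // _.
exists (linfun (aact u) @: specht R t)%VS; split; first exact: iso_submod_image tab ud u0.
apply/memv_imgP; exists (F * young R t : A); last by rewrite lfunE.
by apply/spechtP; exists F.
Qed.

(** Invariance comes from the leftmost factor, the row sum. For membership in the isotypic
    component, each conjugate in [conj_sum] yields a left multiple of [young R t] acting on a
    translate of [u]. *)
Lemma in_W_aact la t u F (b : R) : is_tableau la t -> deg_le d u ->
  in_W d t (aact u (row_sum R t * F * (b *: conj_sum (young R t)))).
Proof.
move=> tab ud; split; last first.
  move=> s sR; rewrite -aact_delta -aactM !mulrA.
  by rewrite (delta_row_sum R sR).
rewrite -scalerAr scalerAl; set G := b *: _.
rewrite mulr_sumr linear_sum; apply: big_ind => [||g _]; first exact: isotypic0.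
  exact: isotypicD.
rewrite /= mulrA aactM mulrA aact_delta; apply: isotypic_aact tab _.
exact: deg_le_pact.
Qed.

Lemma edge_act_tperm i j (e : edge n) : i \notin val e -> j \notin val e ->
  edge_act (tperm i j) e = e.
Proof.
move=> ie je; apply: val_inj => /=; rewrite -[RHS]imset_id; apply: eq_in_imset => k ke.
by apply: tpermD; apply: contraTneq ke => <-.
Qed.

(* A monomial of degree at most d involves at most 2d labels, so two of the
   remaining labels share a column as soon as there are fewer than n - 2d
   columns; their transposition fixes the monomial. *)
Lemma col_sum_mono la t (S : {set edge n}) : is_tableau la t ->
  (#|S| <= d)%N -> (nth 0 (parts la) 0 < n - 2 * d)%N ->
  aact (mono R S) (col_sum R t) = 0.
Proof.
move=> tab Sd short; set w := nth 0%N _ _ in short.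
pose B := ~: \bigcup_(e in S) val e.
have cB : (w < #|B|)%N.
  have := cardsC (\bigcup_(e in S) val e); rewrite card_ord -/B.
  have : (#|\bigcup_(e in S) val e| <= 2 * d)%N.
    apply: (@leq_trans (\sum_(e in S) 2)%N); last by rewrite sum_nat_const mulnC leq_mul2l Sd.
    apply: (big_ind2 (fun (X : {set 'I_n}) m => #|X| <= m)%N) => [|X k Y m Xk Ym|e _].
    - by rewrite cards0.
    - by apply: leq_trans (leq_card_setU X Y) (leq_add Xk Ym).
    by rewrite (eqP (valP e)).
  by lia.
have colw i : ((t i).2 < w)%N.
  case: tab => _ [tin _]; exact: leq_trans (tin i) (parts_nonincreasing la (leq0n _)).
pose f i := Ordinal (colw i).
have : ~~ dinjectiveb f (mem B).
  by apply/negP => /dinjectiveP/leq_card_in; rewrite card_ord leqNgt cB.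
case/dinjectivePn => i iB [j]; rewrite !inE => /andP[nij jB] fij.
have ij : (t i).2 = (t j).2 by case: fij.
have fixS : pact (tperm i j) (mono R S) = mono R S.
  rewrite pact_mono; congr (mono R _); rewrite -[RHS]imset_id; apply: eq_in_imset => e eS.
  apply: edge_act_tperm.
    by move: iB; rewrite !inE; apply: contra => ie; apply/bigcupP; exists e.
  by move: jB; rewrite ?inE; apply: contra => je; apply/bigcupP; exists e.
have := aactM (mono R S) (col_sum R t) (delta R (tperm i j)).
rewrite col_sum_delta ?tperm_colgroup // odd_tperm eq_sym nij expr1 aact_delta fixS.
rewrite [LHS]linearZ /= scaleN1r => e; apply/ffunP => x; rewrite ffunE; apply/eqP.
have := congr1 (fun v : fn R n => v x) e; rewrite ffunE => /eqP.
by rewrite (eqNr (aact (mono R S) (col_sum R t) x : R)).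
Qed.

Lemma lex_le_nseq1 m (s : seq nat) : all (leq 1) s -> (m <= sumn s)%N ->
  lex_le (nseq m 1%N) s.
Proof.
elim: s m => [|y s IH] [|m] //= /andP[y0 s0] le.
case: ltnP => //= y1; have {y0 y1 le}[-> le] : y = 1%N /\ (m <= sumn s)%N by lia.
by rewrite eqxx IH.
Qed.

(** A first part above [n - 2 * d] decides the lexicographic comparison at once; if it is equal, the
    remaining parts sum to [2 * d], and the list of ones is the least such list. *)
Lemma notin_Lambda la : (0 < n)%N -> ~~ inLambda d la ->
  (nth 0 (parts la) 0 < n - 2 * d)%N.
Proof.
move=> n0; apply: contraNT; rewrite -leqNgt /inLambda.
move: (sumn_parts la) (parts_gt0 la).
case: (parts la) => [|x s] /= sn; first by rewrite -sn in n0.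
case/andP=> x0 s0 le; case: ltnP => //= lex.
have e : (n - 2 * d)%N = x by apply/eqP; rewrite eqn_leq le.
by rewrite e eqxx lex_le_nseq1 //; lia.
Qed.

(** In each conjugate of the Young symmetrizer the column sum acts before the row sum, on a
    translate of [u], and by [col_sum_mono] it annihilates every function of degree at most [d]. *)
Lemma aact_young_notin_Lambda la t u F (b : R) : (0 < n)%N -> is_tableau la t ->
  ~~ inLambda d la -> deg_le d u ->
  aact u (F * (b *: conj_sum (young R t))) = 0.
Proof.
move=> n0 tab /(notin_Lambda n0) short ud.
have q0 v : deg_le d v -> aact v (col_sum R t) = 0.
  move=> [c ->]; rewrite aact_suml big1 // => S Sd.
  by rewrite (col_sum_mono tab) ?scaler0.
rewrite aactM (_ : aact u _ = 0) ?aact0 //.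
rewrite linearZ linear_sum big1 /= ?scaler0 // => g _.
by rewrite !aactM !aact_delta youngE aactM q0 ?aact0 ?linear0 //; apply: deg_le_pact.
Qed.
End Isotypic.

(** * The decomposition *)

Section PositiveSemidefinite.
Variables (R : realType) (l : nat).
Implicit Types (M N : 'M[R]_l).

Lemma psdD M N : psd M -> psd N -> psd (M + N).
Proof.
move=> [sM pM] [sN pN]; split=> [|x]; first by rewrite linearD /= sM sN.
by rewrite mulmxDr mulmxDl mxE addr_ge0.
Qed.

Lemma psdZ (a : R) M : 0 <= a -> psd M -> psd (a *: M).
Proof.
move=> a0 [sM pM]; split=> [|x]; first by rewrite linearZ /= sM.
by rewrite -scalemxAr -scalemxAl mxE mulr_ge0.
Qed.

Lemma psd_sum (I : finType) (M : I -> 'M[R]_l) :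
  (forall i, psd (M i)) -> psd (\sum_i M i).
Proof.
move=> pM; apply: big_ind => //; last exact: psdD.
by split=> [|x]; rewrite ?trmx0 // mulmx0 mul0mx mxE.
Qed.

Lemma psd_rank1 (v : 'cV[R]_l) : psd (v *m v^T).
Proof.
split=> [|x]; first by rewrite trmx_mul trmxK.
rewrite mulmxA -mulmxA -[v^T *m x]trmxK trmx_mul trmxK mxE big_ord1.
by rewrite [X in _ * X]mxE -expr2 sqr_ge0.
Qed.

End PositiveSemidefinite.

(** * Traces against the matrix of symmetrized products *)

Section QuadraticForm.
Variables (R : realType) (n l : nat) (ps : 'I_l -> fn R n).

(** This is tr(M Z) written out, whence the swapped indices. *)
Definition Zform (M : 'M[R]_l) : fn R n :=
  \sum_(i < l) \sum_(j < l) M i j *: Zmat ps j i.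

Lemma Zform_is_linear : linear Zform.
Proof.
move=> a M N; rewrite /Zform scaler_sumr -big_split; apply: eq_bigr => i _ /=.
rewrite scaler_sumr -big_split; apply: eq_bigr => j _ /=.
by rewrite !mxE scalerDl scalerA.
Qed.

HB.instance Definition _ :=
  GRing.isLinear.Build R 'M[R]_l (fn R n) _ Zform Zform_is_linear.

Lemma Zform_rank1 (c : 'cV[R]_l) :
  Zform (c *m c^T) = sym (fmul (\sum_i c i 0 *: ps i) (\sum_i c i 0 *: ps i)).
Proof.
rewrite 2!linear_sum; apply: eq_bigr => i _ /=; rewrite fmulC !linear_sum.
apply: eq_bigr => j _ /=; rewrite mxE big_ord1 mxE.
have -> : fmul (c i 0 *: ps i) (c j 0 *: ps j) =
    (c i 0 * c j 0) *: fmul (ps j) (ps i).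
  apply/ffunP => x; rewrite !ffunE; apply: etrans (mulrACA _ _ _ _) _.
  by congr (_ * _); apply: mulrC.
by rewrite [RHS]linearZ.
Qed.

End QuadraticForm.

Theorem theorem2p8 (R : realType) (n d : nat) (hn : (0 < n)%N) (hd : (0 < d)%N)
  (p : fn R n) (hinv : Sn_invariant p) (hsos : is_dsos d p)
  (tau : npartition n -> 'I_n -> nat * nat)
  (htau : forall la, is_tableau la (tau la))
  (l : npartition n -> nat) (ps : forall la : npartition n, 'I_(l la) -> fn R n)
  (hspan : forall la v, in_W d (tau la) v -> in_span (ps la) v) :
  exists Rm : forall la : npartition n, 'M[R]_(l la),
    (forall la, inLambda d la -> psd (Rm la)) /\
    p = \sum_(la : npartition n | inLambda d la)
          \sum_(i < l la) \sum_(j < l la) Rm la i j *: Zmat (ps la) j i.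
Proof.
have [m [fs [fs_deg pE]]] := hsos.
have [k [b [k0 one]]] := one_sum_star_squares R htau.
set x := fun la g => _ in one.
(* By [in_W_aact], [x la g] sends [fs i] into W, so the image expands in [ps la]. *)
have coef la i g : exists c : 'cV[R]_(l la),
    aact (fs i) (x la g) = \sum_j c j 0 *: ps la j.
  have [c cE] := hspan _ _ (in_W_aact (delta R g) (b la) (htau la) (fs_deg i)).
  by exists (\col_j c j); rewrite cE; apply: eq_bigr => j _; rewrite mxE.
pose c la i g := projT1 (cid (coef la i g)).
have cE la i g : aact (fs i) (x la g) = \sum_j c la i g j 0 *: ps la j.
  exact: projT2 (cid (coef la i g)).
(* Each square of an [aact (fs i) (x la g)] contributes the rank-one matrix of its coefficients,
   weighted by [k la]. *)
exists (fun la => k la *: \sum_i \sum_g c la i g *m (c la i g)^T); split=> [la _|].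
  by apply: psdZ => //; apply: psd_sum => i; apply: psd_sum => g; apply: psd_rank1.
have symE i : sym (fmul (fs i) (fs i)) =
    \sum_(la | inLambda d la) k la *: \sum_g Zform (ps la) (c la i g *m (c la i g)^T).
  (* The decomposition of 1 is applied to only one of the two factors [fs i]; [sym_fmul_star] then
     moves half of each term to the other factor. *)
  have fsE : fs i = \sum_la k la *: \sum_g aact (fs i) (star (x la g) * x la g).
    rewrite -[LHS]aact1 one linear_sum; apply: eq_bigr => la _.
    by rewrite linearZ linear_sum.
  rewrite {1}fsE fmulC !linear_sum [RHS]big_mkcond.
  apply: eq_bigr => la _; rewrite !linearZ !linear_sum /=.
  case: ifP => [_|/negbT nla]; last rewrite big1 ?scaler0 // => g _.
    rewrite scaler_sumr; apply: eq_bigr => g _; congr (_ *: _).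
    by rewrite fmulC sym_fmul_star Zform_rank1 -cE.
  rewrite fmulC sym_fmul_star.
  by rewrite (aact_young_notin_Lambda _ _ hn (htau la) nla (fs_deg i)) !linear0.
(* Symmetrization fixes [p], so each square may be replaced by its symmetrization. *)
rewrite -[LHS](sym_id hinv) pE linear_sum; under eq_bigr => i _ do rewrite /= symE.
rewrite exchange_big; apply: eq_bigr => la _ /=.
rewrite -/(Zform (ps la) _) linearZ linear_sum /= scaler_sumr.
by apply: eq_bigr => i _; congr (_ *: _); rewrite linear_sum.
Qed.
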